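(* Let $\mathcal{E}$ be the ellipse $\frac{x^2}{a}+\frac{y^2}{b}=1$ ($a,b>0$) in the Minkowski plane. The flow of light-like billiard trajectories within $\mathcal{E}$ is trajectorially equivalent to the flow of those (usual, Euclidean) billiard trajectories within a rectangle whose angle with the sides is $\frac{\pi}{4}$. The ratio of the sides of the rectangle is equal to $$\frac{\pi}{2\arctan\sqrt{\dfrac ab}}-1.$$
   Context: The Minkowski plane $\mathbf{E}^{1,1}$ is $\mathbf{R}^2$ with the scalar product $\langle (x,y),(x',y')\rangle=xx'-yy'$. A line is light-like if its direction vector $v\neq0$ satisfies $\langle v,v\rangle=0$. Billiard reflection: given a line $\alpha$ (the tangent to the boundary at the reflection point) decompose a vector $v=u+n_\alpha$ with $u$ parallel to $\alpha$ and $n_\alpha$ orthogonal to $\alpha$ with respect to $\langle\cdot,\cdot\rangle$; the reflected vector is $v'=u-n_\alpha$. Billiard motion within $\mathcal{E}$ is uniform and straight inside $\mathcal{E}$ and obeys this reflection law on $\mathcal{E}$. Reflection preserves the light-like type of a segment's line; a trajectory is light-like if its segments lie on light-like lines. At points of $\mathcal{E}$ where the tangent line is light-like, a vector $v$ is by convention reflected into $-v$, and such a reflection is counted as two reflections. Trajectorially equivalent flows: in the usual sense of orbital equivalence, i.e. there is a homeomorphism between the phase spaces mapping trajectories of one flow onto trajectories of the other. *)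

(* Defs.v *)
From HB Require Import structures.
From mathcomp Require Import all_boot all_order all_algebra generic_quotient.
From mathcomp Require Import all_classical all_reals all_analysis.
Import Order.TTheory GRing.Theory Num.Theory numFieldNormedType.Exports.

Set Implicit Arguments.
Unset Strict Implicit.
Unset Printing Implicit Defensive.

Local Open Scope classical_set_scope.
Local Open Scope quotient_scope.
Local Open Scope ring_scope.

Section Plane.
Variable R : realType.
Implicit Types u v : R * R.

Definition minkowski u v : R := u.1 * v.1 - u.2 * v.2.
Definition euclid u v : R := u.1 * v.1 + u.2 * v.2.

Definition lightlike v : Prop := v <> 0 /\ minkowski v v = 0.

(* v' is the image of v under the billiard reflection off a line of direction
   d, for the scalar product B. *)
Definition reflection (B : R * R -> R * R -> R) (d v v' : R * R) : Prop :=
  exists (k : R) (n : R * R),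
    [/\ B n d = 0, v = k *: d + n & v' = k *: d - n].

End Plane.

(* A state is a point of the closed table with a direction of motion; since
   orbital equivalence ignores the parametrization of trajectories, directions
   are represented by vectors of Euclidean norm 1. *)
Record billiard (R : realType) := Billiard {
  table : set (R * R);
  inside : set (R * R);
  directions : set (R * R);
  (* bounce p v v' : at the boundary point p, v is reflected into v' *)
  bounce : R * R -> R * R -> R * R -> Prop }.

Section Billiard.
Variables (R : realType) (T : billiard R).

Definition states : set ((R * R) * (R * R)) := table T `*` directions T.

Definition pos (s : states) : R * R := (set_val s).1.
Definition dir (s : states) : R * R := (set_val s).2.

Definition bounces (s s' : states) : Prop :=
  pos s = pos s' /\ bounce T (pos s) (dir s) (dir s').

Inductive flow : states -> R -> states -> Prop :=
| flow_free s t s' :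
    0 <= t -> dir s' = dir s -> pos s' = pos s + t *: dir s ->
    (forall r, 0 < r < t -> inside T (pos s + r *: dir s)) ->
    flow s t s'
| flow_bounce s s' : bounces s s' -> flow s 0 s'
| flow_trans s t s' t' s'' :
    flow s t s' -> flow s' t' s'' -> flow s (t + t') s''.

Definition is_equivalence (X : Type) (E : set (X * X)) : Prop :=
  [/\ forall x, E (x, x),
      forall x y, E (x, y) -> E (y, x) &
      forall x y z, E (x, y) -> E (y, z) -> E (x, z)].

(* The states before and after a reflection are the same point of the phase
   space. One takes the smallest *closed* equivalence relation containing the
   reflection law: the reflections v |-> -v (at the corners of a rectangle, or
   where the tangent is light-like) stand for two reflections, and the closure
   adds the intermediate direction between them; without it the quotient is
   not Hausdorff at these points. *)
Definition identified (s s' : states) : Prop :=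
  forall E : set (states * states), closed E -> is_equivalence E ->
    (forall x y, bounces x y -> E (x, y)) -> E (s, s').

Definition identifiedb (s s' : states) : bool := `[< identified s s' >].

Lemma identifiedb_refl : reflexive identifiedb.
Proof. by move=> s; apply/asboolP => E _ [Er _ _] _; exact: Er. Qed.

Lemma identifiedb_sym : symmetric identifiedb.
Proof.
move=> s s'; apply/asboolP/asboolP => h E cE eE bE;
  by case: (eE) => _ Es _; apply: Es; exact: h.
Qed.

Lemma identifiedb_trans : transitive identifiedb.
Proof.
move=> y x z /asboolP h /asboolP h'; apply/asboolP => E cE eE bE.
by case: (eE) => _ _ Et; apply: (Et _ y); [exact: h|exact: h'].
Qed.

Definition identified_equiv : equiv_rel states :=
  EquivRel identifiedb identifiedb_refl identifiedb_sym identifiedb_trans.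

Definition phase_space : topologicalType :=
  quotient_topology {eq_quot identified_equiv}.

Definition to_phase (s : states) : phase_space :=
  \pi_(quotient_topology {eq_quot identified_equiv}) s.

Definition trajectory (x : phase_space) : set phase_space :=
  [set y | exists s s' t, [/\ to_phase s = x, to_phase s' = y &
                             flow s t s' \/ flow s' t s]].

End Billiard.

Definition trajectorially_equivalent (R : realType) (T1 T2 : billiard R) :=
  exists (h : phase_space T1 -> phase_space T2)
         (g : phase_space T2 -> phase_space T1),
    [/\ continuous h, continuous g, cancel h g, cancel g h &
        forall x, h @` trajectory x = trajectory (h x)].

Section Tables.
Variable R : realType.
Implicit Types p v : R * R.

Definition ellipse_form (a b : R) p : R := p.1 ^+ 2 / a + p.2 ^+ 2 / b.

(* Orthogonal, in the Euclidean sense, to the gradient (2x/a, 2y/b). *)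
Definition ellipse_tangent (a b : R) p : R * R := (- (p.2 / b), p.1 / a).

(* The Minkowski reflection of a light-like vector changes its Euclidean norm,
   whence the positive factor c. *)
Definition ellipse_bounce (a b : R) p v v' : Prop :=
  let d := ellipse_tangent a b p in
  [/\ ellipse_form a b p = 1,
      lightlike d -> v' = - v &
      ~ lightlike d ->
        exists2 c : R, 0 < c & reflection (@minkowski R) d v (c *: v')].

Definition lightlike_ellipse_billiard (a b : R) : billiard R :=
  {| table := [set p | ellipse_form a b p <= 1];
     inside := [set p | ellipse_form a b p < 1];
     directions := [set v | lightlike v /\ euclid v v = 1];
     bounce := ellipse_bounce a b |}.

(* At a corner, reflecting in both sides yields - v. *)
Definition rectangle_bounce (l1 l2 : R) p v v' : Prop :=
  let on_vertical := p.1 = 0 \/ p.1 = l1 in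
  let on_horizontal := p.2 = 0 \/ p.2 = l2 in
  [\/ [/\ on_vertical, on_horizontal & v' = - v],
      [/\ on_vertical, ~ on_horizontal & reflection (@euclid R) (0, 1) v v'] |
      [/\ ~ on_vertical, on_horizontal & reflection (@euclid R) (1, 0) v v']].

(* The rectangle is [0, l1] x [0, l2]; the last two conditions on directions
   say that the angle of the line of v with each side is pi / 4. *)
Definition diagonal_rectangle_billiard (l1 l2 : R) : billiard R :=
  {| table := [set p | 0 <= p.1 <= l1 /\ 0 <= p.2 <= l2];
     inside := [set p | 0 < p.1 < l1 /\ 0 < p.2 < l2];
     directions := [set v | [/\ euclid v v = 1,
       `|euclid v (1, 0)| = cos (pi / 4) & `|euclid v (0, 1)| = cos (pi / 4)]];
     bounce := rectangle_bounce l1 l2 |}.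

End Tables.

(* Main.v *)
(* Write s^2 = a + b, a = s^2 cos^2 phi and b = s^2 sin^2 phi. On the ellipse
   table put x - y = s cos X and x + y = s cos Y with X, Y in [0, pi]: light-like
   lines become the lines parallel to the axes of the (X, Y)-plane. With
   A = (X + Y) / 2 and B = (X - Y) / 2 one has x = s cos A cos B and
   y = s sin A sin B, and x^2/a + y^2/b - 1 is a positive multiple of
   (cos^2 A - cos^2 phi) (cos^2 B - cos^2 phi), so that the table becomes the
   rectangle phi <= A <= pi - phi, |B| <= phi, whose sides make angles pi / 4
   with the axes of X and Y. The points with a light-like tangent become its
   corners. The resulting homeomorphism between the spaces of states commutes
   with the reflections and preserves oriented free motion, hence descends to
   the phase spaces. *)
Require Import Defs.
From mathcomp Require Import all_boot all_order all_algebra generic_quotient.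
From mathcomp Require Import all_classical all_reals all_analysis.
From mathcomp Require Import ring lra.
Import Order.TTheory GRing.Theory Num.Theory numFieldNormedType.Exports.
Set Implicit Arguments.
Unset Strict Implicit.
Unset Printing Implicit Defensive.

Local Open Scope classical_set_scope.
Local Open Scope quotient_scope.
Local Open Scope ring_scope.

Lemma continuous_pair (X Y Z : topologicalType) (f : X -> Y) (g : X -> Z) :
  continuous f -> continuous g -> continuous (fun x => (f x, g x)).
Proof. by move=> cf cg x; exact: (cvg_pair (cf x) (cg x)). Qed.

(** * Morphisms of billiards and the maps they induce on phase spaces *)

Section Morphism.
Variables (R : realType) (T1 T2 : billiard R).
Implicit Types f : states T1 -> states T2.

(** These are the properties that let a map of states descend to phase spaces and carry trajectories
    into trajectories. The time [t'] is unconstrained, since only orbits are compared. *)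
Definition billiard_morphism f : Prop :=
  [/\ continuous f,
      forall s s', bounces s s' -> bounces (f s) (f s') &
      forall s t s', flow s t s' -> exists t', flow (f s) t' (f s')].

(** Induction on [flow]. The second hypothesis is asked without the condition that the open segment
    lies inside: for both tables this condition follows from the end points being states. *)
Lemma flow_morphism f :
  (forall s s', bounces s s' -> bounces (f s) (f s')) ->
  (forall s t s', 0 <= t -> dir s' = dir s -> pos s' = pos s + t *: dir s ->
     exists t', flow (f s) t' (f s')) ->
  forall s t s', flow s t s' -> exists t', flow (f s) t' (f s').
Proof.
move=> fb ff s t s'; elim=> {s t s'}.
- by move=> s t s' t0 ds ps _; exact: ff t0 ds ps.
- by move=> s s' /fb b; exists 0; exact: flow_bounce.
- move=> s t s' t' s'' _ [r fr] _ [r' fr'].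
  by exists (r + r'); exact: flow_trans fr fr'.
Qed.

(** The preimage under f x f of a closed equivalence relation containing the reflections of [T2] is
    again closed, an equivalence relation, and contains the reflections of [T1]. *)
Lemma identified_morphism f s s' :
  billiard_morphism f -> identified s s' -> identified (f s) (f s').
Proof.
move=> [cf fb _] ss' E cE [Er Es Et] bE.
have cff : continuous (fun x : states T1 * states T1 => (f x.1, f x.2)).
  apply: continuous_pair => x.
  - by apply: continuous_comp; [exact: cvg_fst|exact: cf].
  - by apply: continuous_comp; [exact: cvg_snd|exact: cf].
apply: (ss' [set x | E (f x.1, f x.2)]).
- by apply: preimage_closed cE => x _; exact: cff.
- split=> /=; first by move=> x; exact: Er.
  + by move=> x y; exact: Es.
  + by move=> x y z; exact: Et.
- by move=> x y /fb /bE.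
Qed.

Lemma to_phase_eq (T : billiard R) (s s' : states T) :
  to_phase s = to_phase s' <-> identified s s'.
Proof.
split=> [h|h]; first by apply/asboolP; exact/(eqmodP (identified_equiv T)).
exact/(eqmodP (identified_equiv T))/asboolP.
Qed.

(** Defined for every [f] through a chosen representative; the value is independent of that choice
    once [f] is a morphism. *)
Definition phase_map f (x : phase_space T1) : phase_space T2 :=
  to_phase (f (repr x)).

Lemma phase_map_to_phase f s :
  billiard_morphism f -> phase_map f (to_phase s) = to_phase (f s).
Proof.
move=> fm; apply/to_phase_eq; apply: identified_morphism => //.
by apply/to_phase_eq; exact: reprK.
Qed.

Lemma phase_map_continuous f : billiard_morphism f -> continuous (phase_map f).
Proof.
move=> fm; apply/quotient_continuous.
have -> : phase_map f \o \pi_(quotient_topology {eq_quot identified_equiv T1})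
    = @to_phase _ T2 \o f.
  by apply/funext => s; exact: phase_map_to_phase.
move=> s; apply: continuous_comp; first by case: fm => cf _ _; exact: cf.
exact: pi_continuous.
Qed.

Lemma phase_map_trajectory f x y : billiard_morphism f ->
  trajectory x y -> trajectory (phase_map f x) (phase_map f y).
Proof.
move=> fm [s [s' [t [<- <- st]]]]; rewrite !phase_map_to_phase//.
by case: fm st => _ _ ff [] /ff[t' ft'];
  exists (f s), (f s'), t'; split=> //; [left|right].
Qed.

End Morphism.

Lemma to_phase_repr (R : realType) (T : billiard R) (x : phase_space T) :
  to_phase (repr x) = x.
Proof. exact: reprK. Qed.

Lemma phase_mapK (R : realType) (T1 T2 : billiard R)
    (f : states T1 -> states T2) (g : states T2 -> states T1) :
  billiard_morphism f -> billiard_morphism g -> cancel f g ->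
  cancel (phase_map f) (phase_map g).
Proof.
by move=> fm gm fK x; rewrite -[x]to_phase_repr !phase_map_to_phase// fK.
Qed.

(** Each morphism sends a trajectory into a trajectory; the inclusion for [g], transported by [f],
    shows that the image under [f] is the whole trajectory. *)
Lemma isomorphic_equivalent (R : realType) (T1 T2 : billiard R)
    (f : states T1 -> states T2) (g : states T2 -> states T1) :
  billiard_morphism f -> billiard_morphism g -> cancel f g -> cancel g f ->
  trajectorially_equivalent T1 T2.
Proof.
move=> fm gm fK gK; exists (phase_map f), (phase_map g).
have fK' := phase_mapK fm gm fK; have gK' := phase_mapK gm fm gK.
split=> //; [exact: phase_map_continuous..|] => x.
apply/seteqP; split=> [_ [y xy <-]|y xy]; first exact: phase_map_trajectory.
exists (phase_map g y); last exact: gK'.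
by rewrite -[x]fK'; exact: phase_map_trajectory.
Qed.

(** A subset viewed as a type carries the initial topology of its inclusion. *)
Lemma continuous_set_type (X : topologicalType) (Y : topologicalType) (A : set Y)
    (f : X -> A) :
  continuous (set_val \o f) -> continuous f.
Proof. exact: continuous_comp_initial. Qed.

Lemma set_val_continuous (X : topologicalType) (A : set X) :
  continuous (set_val : A -> X).
Proof. exact: initial_continuous. Qed.

(** * Continuity of the arc cosine on the closed interval [-1, 1] *)

Section Acos.
Variable R : realType.

Lemma ler_cos : {in `[0, pi] &, {mono (@cos R) : x y /~ y <= x}}.
Proof. by move=> x y xI yI; rewrite !leNgt ltr_cos. Qed.

(** A decreasing function on a segment that takes every value between its extreme ones is
    continuous. The end points are included because the arguments -1 and 1 occur at the points with
    a light-like tangent. *)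
Lemma acos_within_continuous : {within `[-1, 1], continuous (@acos R)}.
Proof.
apply: segment_dec_surj_continuous.
  move=> x y; rewrite !in_itv/= => x1 y1.
  rewrite -ler_cos; last 2 first.
  - by rewrite in_itv/= acos_ge0//= acos_lepi.
  - by rewrite in_itv/= acos_ge0//= acos_lepi.
  by rewrite !acosK// in_itv.
move=> y /=; rewrite acos1 acosN1 => yI; exists (cos y); last by rewrite cosK.
by rewrite /= in_itv/= cos_geN1 cos_le1.
Qed.

(** The map [f] factors through the subspace [-1, 1], on which [acos] is continuous. *)
Lemma continuous_acos_comp (T : topologicalType) (f : T -> R) :
  (forall x, -1 <= f x <= 1) -> continuous f -> continuous (acos \o f).
Proof.
move=> fI cf.
pose A : set R := `[-1, 1]%classic.
have fI' x : f x \in A by apply/mem_set; rewrite /A/= in_itv/= fI.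
pose g x : A := exist _ (f x) (fI' x).
have -> : acos \o f = sigL A acos \o g.
  by apply/funext => x; rewrite /sigL/= set_valE.
move=> x; apply: continuous_comp.
  apply: continuous_set_type.
  suff -> : set_val \o g = f by exact: cf.
  by apply/funext => y; rewrite /= set_valE.
suff ca : continuous (sigL A (@acos R)) by exact: ca.
by apply/subspace_sigL_continuousP; exact: acos_within_continuous.
Qed.

End Acos.

(** * Admissible directions and explicit reflection laws *)

Section Directions.
Variable R : realType.
Implicit Types p v d : R * R.

(** The common description of the directions of both billiards: four vectors, with coordinates plus
    or minus the square root of 1/2. *)
Definition diagonal_direction v := v.1 ^+ 2 = 1 / 2 /\ v.2 ^+ 2 = 1 / 2.

Lemma pairE (x y : R * R) : x.1 = y.1 -> x.2 = y.2 -> x = y.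
Proof. by case: x y => [? ?] [? ?] /= -> ->. Qed.

Lemma lightlikeE v : lightlike v <-> v.1 ^+ 2 = v.2 ^+ 2 /\ v <> 0.
Proof.
rewrite /lightlike /Defs.minkowski; split=> -[h1 h2]; split=> //.
  by rewrite !expr2; apply/eqP; rewrite -subr_eq0; apply/eqP.
by rewrite -!expr2 h1 subrr.
Qed.

Lemma lightlike_directionE v : lightlike v /\ euclid v v = 1 <-> diagonal_direction v.
Proof.
rewrite lightlikeE /euclid /diagonal_direction -!expr2; split=> [[[h _] h']|[h h']].
  by split; lra.
split; last by lra.
split; first by lra.
by move=> v0; move: h; rewrite v0 /= expr0n/=; lra.
Qed.

Lemma cos_pi4_sqr : cos (pi / 4) ^+ 2 = 1 / 2 :> R.
Proof.
have := cos_mulr2n (pi / 4 : R).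
have -> : pi / 4 *+ 2 = pi / 2 :> R by rewrite -mulr_natr; lra.
by rewrite cos_pihalf -mulr_natr; lra.
Qed.

Lemma cos_pi4_ge0 : 0 <= cos (pi / 4) :> R.
Proof. by have := pi_gt0 R => pi0; apply: cos_ge0_pihalf; apply/andP; split; lra. Qed.

Lemma norm_cos_pi4 (x : R) : `|x| = cos (pi / 4) <-> x ^+ 2 = 1 / 2.
Proof.
split=> [h|h]; first by rewrite -real_normK ?num_real// h cos_pi4_sqr.
apply/eqP; rewrite -(eqrXn2 (ltn0Sn 1)) ?cos_pi4_ge0//.
by rewrite cos_pi4_sqr real_normK ?num_real// h.
Qed.

Lemma rectangle_directionE v :
  [/\ euclid v v = 1, `|euclid v (1, 0)| = cos (pi / 4) &
      `|euclid v (0, 1)| = cos (pi / 4)] <-> diagonal_direction v.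
Proof.
rewrite /euclid /diagonal_direction/= !mulr1 !mulr0 addr0 add0r -!expr2.
split=> [[_ /norm_cos_pi4 h1 /norm_cos_pi4 h2]|[h1 h2]] //.
by split; [lra|exact/norm_cos_pi4..].
Qed.

Lemma diagonal_neq0 v : diagonal_direction v -> v.1 != 0 /\ v.2 != 0.
Proof.
by move=> [h1 h2]; split; apply/eqP => v0; move: h1 h2; rewrite v0 expr0n/=; lra.
Qed.

Lemma diagonal_cases v : diagonal_direction v -> v.2 = v.1 \/ v.2 = - v.1.
Proof.
move=> [h1 h2]; have /eqP : v.2 ^+ 2 = v.1 ^+ 2 by lra.
by rewrite eqf_sqr => /orP[] /eqP; [left|right].
Qed.

(** For [d] not light-like the reflection is v |-> 2 (<v, d> / <d, d>) d - v. With v.2 = e v.1 and e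
    = 1 or -1, it becomes the given multiple of (v.1, - v.2), whose sign is governed by <d, d>. *)
Lemma minkowski_reflectionE d v w : d.1 ^+ 2 != d.2 ^+ 2 -> diagonal_direction v ->
  reflection (@Defs.minkowski R) d v w <->
  w = ((d.1 - v.2 / v.1 * d.2) ^+ 2 / (d.1 ^+ 2 - d.2 ^+ 2)) *: (v.1, - v.2).
Proof.
move=> dd dv; have [v10 _] := diagonal_neq0 dv.
have D0 : d.1 ^+ 2 - d.2 ^+ 2 != 0 by rewrite subr_eq0.
have -> : ((d.1 - v.2 / v.1 * d.2) ^+ 2 / (d.1 ^+ 2 - d.2 ^+ 2)) *: (v.1, - v.2)
  = (2 * ((d.1 * v.1 - d.2 * v.2) / (d.1 ^+ 2 - d.2 ^+ 2))) *: d - v.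
  by apply: pairE; rewrite /= /GRing.scale/=;
    case: (diagonal_cases dv) => ->; field; rewrite v10 D0.
set k := _ / (d.1 ^+ 2 - d.2 ^+ 2).
split=> [[k' [n [nd vE ->]]]|->].
  have -> : k = k'.
    apply: (mulIf D0); rewrite /k divfK//.
    move: nd; rewrite vE /Defs.minkowski /= /GRing.scale/= => nd.
    lra.
  by rewrite vE; apply: pairE => /=; rewrite /GRing.scale/=; ring.
exists k, (v - k *: d); split.
- rewrite /Defs.minkowski /k /= /GRing.scale/=; field; exact: D0.
- by apply: pairE => /=; rewrite /GRing.scale/=; ring.
- by apply: pairE => /=; rewrite /GRing.scale/=; ring.
Qed.

(** The reflected vector is [g] times (v.1, - v.2). As c > 0 only the ray matters, so the sign of
    [g], which is that of <d, d>, selects (v.1, - v.2) or its opposite. *)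
Lemma minkowski_bounceE d v v' : diagonal_direction v -> diagonal_direction v' ->
  d.1 ^+ 2 != d.2 ^+ 2 ->
  (exists2 c : R, 0 < c & reflection (@Defs.minkowski R) d v (c *: v')) <->
  (d.1 ^+ 2 < d.2 ^+ 2 /\ v' = (- v.1, v.2)) \/
  (d.2 ^+ 2 < d.1 ^+ 2 /\ v' = (v.1, - v.2)).
Proof.
move=> dv dv' dd; have [v10 _] := diagonal_neq0 dv.
set g := (d.1 - v.2 / v.1 * d.2) ^+ 2 / (d.1 ^+ 2 - d.2 ^+ 2).
have e0 : 0 < (d.1 - v.2 / v.1 * d.2) ^+ 2.
  rewrite exprn_even_gt0//=; apply: contraNneq dd.
  case: (diagonal_cases dv) => ->; rewrite ?mulNr divff// => h.
    by have -> : d.1 = d.2 by lra.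
  have -> : d.1 = - d.2 by lra.
  by rewrite sqrrN.
split=> [[c c0 /(minkowski_reflectionE _ dd dv)]|].
  rewrite -/g => cv'.
  have c1 : c * v'.1 = g * v.1 by have := congr1 fst cv'.
  have c2 : c * v'.2 = - (g * v.2) by have := congr1 snd cv'; rewrite /= /GRing.scale/= => ->; ring.
  have cg : c ^+ 2 = g ^+ 2.
    have := congr1 (fun z => z ^+ 2) c1; rewrite !exprMn.
    by case: dv dv' => -> _ [-> _] h; lra.
  (* Coordinates of [v] and [v'] have equal squares, so [c] is the absolute value of [g]. *)
  have {cg} /orP[/eqP cg|/eqP cg] : (g == c) || (g == - c) by rewrite -eqf_sqr cg.
  - right; split.
      have : 0 < g by rewrite cg.
      by rewrite /g pmulr_rgt0// invr_gt0 subr_gt0.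
    move: c1 c2; rewrite cg => c1 c2; apply: pairE; apply: (mulfI (lt0r_neq0 c0)) => /=; lra.
  - left; split.
      have : g < 0 by rewrite cg; lra.
      by rewrite /g pmulr_rlt0// invr_lt0 subr_lt0.
    move: c1 c2; rewrite cg => c1 c2; apply: pairE; apply: (mulfI (lt0r_neq0 c0)) => /=; lra.
move=> [] [dl ->].
  exists (- g); first by rewrite oppr_gt0 /g pmulr_rlt0// invr_lt0 subr_lt0.
  by apply/minkowski_reflectionE => //; apply: pairE; rewrite /= /GRing.scale/= -/g; ring.
exists g; first by rewrite /g pmulr_rgt0// invr_gt0 subr_gt0.
by apply/minkowski_reflectionE.
Qed.

Lemma vertical_reflectionE v w :
  reflection (@euclid R) (0, 1) v w <-> w = (- v.1, v.2).
Proof.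
split=> [[k [n [nd -> ->]]]|->].
  move: nd; rewrite /euclid/= => nd.
  by apply: pairE; rewrite /= /GRing.scale/=; lra.
exists v.2, (v.1, 0); split; first by rewrite /euclid/=; ring.
all: by apply: pairE; rewrite /= /GRing.scale/=; ring.
Qed.

Lemma horizontal_reflectionE v w :
  reflection (@euclid R) (1, 0) v w <-> w = (v.1, - v.2).
Proof.
split=> [[k [n [nd -> ->]]]|->].
  move: nd; rewrite /euclid/= => nd.
  by apply: pairE; rewrite /= /GRing.scale/=; lra.
exists v.1, (0, v.2); split; first by rewrite /euclid/=; ring.
all: by apply: pairE; rewrite /= /GRing.scale/=; ring.
Qed.

End Directions.

(** * Comparison of angles through cosines *)

Section Angles.
Variable R : realType.

Lemma ler_cos_sqr (x y : R) : 0 <= x <= pi / 2 -> 0 <= y <= pi / 2 ->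
  (cos x ^+ 2 <= cos y ^+ 2) = (y <= x).
Proof.
move=> /andP[x0 x1] /andP[y0 y1]; have pi0 := pi_gt0 R.
rewrite ler_sqr ?nnegrE ?cos_ge0_pihalf//; try by apply/andP; split; lra.
by apply: ler_cos; rewrite in_itv/=; apply/andP; split; lra.
Qed.

Lemma ltr_cos_sqr (x y : R) : 0 <= x <= pi / 2 -> 0 <= y <= pi / 2 ->
  (cos x ^+ 2 < cos y ^+ 2) = (y < x).
Proof. by move=> xI yI; rewrite !ltNge ler_cos_sqr. Qed.

Lemma cos_sqr_inj (x y : R) : 0 <= x <= pi / 2 -> 0 <= y <= pi / 2 ->
  (cos x ^+ 2 == cos y ^+ 2) = (x == y).
Proof. by move=> xI yI; rewrite !eq_le !ler_cos_sqr// andbC. Qed.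

Lemma cos_sqr_min (x : R) : cos (Num.min x (pi - x)) ^+ 2 = cos x ^+ 2.
Proof.
by case: (leP x (pi - x)) => // _; rewrite addrC cosDpi cosN sqrrN.
Qed.

(** The cosine reverses order on [0, pi], so the displacements of cos y and of y have opposite
    signs. The factor [w] stands for a velocity of either sign: this transports oriented motion from
    angles to their cosines. *)
Lemma cos_monotone (w y y' : R) : 0 <= y <= pi -> 0 <= y' <= pi ->
  (0 <= w * (cos y' - cos y)) = (0 <= w * (y - y')).
Proof.
move=> yI y'I; have yy' : (cos y <= cos y') = (y' <= y).
  by apply: ler_cos; rewrite in_itv.
have y'y : (cos y' <= cos y) = (y <= y') by apply: ler_cos; rewrite in_itv.
case: (ltrgtP w 0) => [w0|w0|->]; last by rewrite !mul0r.
- by rewrite !nmulr_rge0// !subr_le0 y'y.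
- by rewrite !pmulr_rge0// !subr_ge0 yy'.
Qed.

End Angles.

(** * The change of coordinates between the rectangle and the ellipse *)

Section Coordinates.
Variables (R : realType) (s phi m : R).
Hypotheses (s0 : 0 < s) (phi0 : 0 < phi) (phi_pi2 : phi < pi / 2) (m0 : 0 < m).
Implicit Types p q v : R * R.

Let a := (s * cos phi) ^+ 2.
Let b := (s * sin phi) ^+ 2.
Let l1 := m * (2 * phi).
Let l2 := m * (pi - 2 * phi).

(** [alpha] and [beta] are the angles A and B, read off a rectangle scaled by [m] with a corner at
    the origin. The first side runs against B: q.1 = 0 is B = phi. *)
Definition alpha q := phi + q.2 / m.
Definition beta q := phi - q.1 / m.

Definition in_rectangle q := 0 <= q.1 <= l1 /\ 0 <= q.2 <= l2.

Definition inflate q : R * R :=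
  (s * (cos (alpha q) * cos (beta q)), s * (sin (alpha q) * sin (beta q))).

(** The angles X = A + B and Y = A - B, for which x - y = s cos X and x + y = s cos Y. *)
Definition angle_minus p := acos ((p.1 - p.2) / s).
Definition angle_plus p := acos ((p.1 + p.2) / s).

Definition straighten p : R * R :=
  (m * (phi - (angle_minus p - angle_plus p) / 2),
   m * ((angle_minus p + angle_plus p) / 2 - phi)).

(* On directions: X is constant and Y decreasing along (1, 1), which goes to
   (-1, -1), while Y is constant and X decreasing along (1, -1), which is fixed. *)
Definition exchange v : R * R := (- v.2, - v.1).

(* u q and w q have the same squared cosines as alpha q and beta q and, on the
   rectangle, lie in [0, pi / 2], where cos^2 is decreasing. *)
Let u q : R := Num.min (alpha q) (pi - alpha q).
Let w q : R := `|beta q|.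

Let bounds : [/\ 0 < phi, phi < pi / 2 & 0 < (pi : R)].
Proof. by split=> //; exact: pi_gt0. Qed.

Lemma cos_phi_gt0 : 0 < cos phi.
Proof. by have [? ? ?] := bounds; apply: cos_gt0_pihalf; apply/andP; split; lra. Qed.

Lemma sin_phi_gt0 : 0 < sin phi.
Proof. by have [? ? ?] := bounds; apply: sin_gt0_pi; apply/andP; split; lra. Qed.

Let a0 : 0 < a. Proof. by rewrite exprn_gt0// mulr_gt0// cos_phi_gt0. Qed.
Let b0 : 0 < b. Proof. by rewrite exprn_gt0// mulr_gt0// sin_phi_gt0. Qed.

Lemma coord1E q : q.1 = m * (phi - beta q).
Proof. by rewrite /beta; field; rewrite lt0r_neq0. Qed.

Lemma coord2E q : q.2 = m * (alpha q - phi).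
Proof. by rewrite /alpha; field; rewrite lt0r_neq0. Qed.

(** Taking |B| and min (A, pi - A) folds the rectangle along its two axes of symmetry, so that each
    pair of opposite sides gives one inequality. *)
Lemma in_rectangleE q :
  in_rectangle q <-> w q <= phi /\ phi <= u q.
Proof.
have [? ? ?] := bounds.
rewrite /in_rectangle /l1 /l2 coord1E coord2E !(ler_pM2l m0) !(pmulr_rge0 _ m0).
rewrite /w /u ler_norml le_min.
by split=> -[/andP[h1 h2] /andP[h3 h4]]; split; apply/andP; split; lra.
Qed.

Lemma on_verticalE q : (q.1 = 0 \/ q.1 = l1) <-> w q = phi.
Proof.
have [? ? ?] := bounds.
have -> : (q.1 = 0 \/ q.1 = l1) <-> (beta q = phi \/ beta q = - phi).
  rewrite coord1E /l1; split=> -[h|h].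
  - by left; move/eqP: h; rewrite mulf_eq0 gt_eqF//= => /eqP; lra.
  - by right; move/(mulfI (lt0r_neq0 m0)): h; lra.
  - by left; rewrite h subrr mulr0.
  - by right; rewrite h; ring.
rewrite /w; split=> [[] ->|]; [exact: gtr0_norm|by rewrite normrN gtr0_norm|].
by case: (ger0P (beta q)) => _ h; [left|right; lra].
Qed.

Lemma on_horizontalE q : (q.2 = 0 \/ q.2 = l2) <-> u q = phi.
Proof.
have [? ? ?] := bounds.
have -> : (q.2 = 0 \/ q.2 = l2) <-> (alpha q = phi \/ alpha q = pi - phi).
  rewrite coord2E /l2; split=> -[h|h].
  - by left; move/eqP: h; rewrite mulf_eq0 gt_eqF//= => /eqP; lra.
  - by right; move/(mulfI (lt0r_neq0 m0)): h; lra.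
  - by left; rewrite h subrr mulr0.
  - by right; rewrite h; ring.
rewrite /u; split=> [[] ->|].
- by rewrite min_l//; lra.
- by rewrite min_r ?subKr//; lra.
- by case: (leP (alpha q)) => _ h; [left|right; lra].
Qed.

Lemma fold_bounds q : in_rectangle q ->
  [/\ 0 <= w q <= pi / 2, 0 <= u q <= pi / 2, w q <= phi & phi <= u q].
Proof.
have [? ? ?] := bounds.
move=> /in_rectangleE[h1 h2]; split=> //.
- by rewrite {1}/w normr_ge0/=; lra.
- apply/andP; split; first exact: le_trans (ltW phi0) h2.
  rewrite /u ge_min; apply/orP.
  by case: (lerP (alpha q) (pi / 2)) => ?; [left|right; lra].
Qed.

Lemma phi_bounds : 0 <= phi <= pi / 2.
Proof. by have [? ? ?] := bounds; apply/andP; split; lra. Qed.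

(** Once denominators are cleared [s] cancels, and replacing every sin^2 by 1 - cos^2 factors the
    equation of the ellipse into those of the two pairs of sides. *)
Lemma form_inflate q :
  (ellipse_form a b (inflate q) - 1) * (cos phi ^+ 2 * sin phi ^+ 2) =
  (cos (u q) ^+ 2 - cos phi ^+ 2) * (cos (w q) ^+ 2 - cos phi ^+ 2).
Proof.
have cphi := lt0r_neq0 cos_phi_gt0; have sphi := lt0r_neq0 sin_phi_gt0.
have s0' := lt0r_neq0 s0.
rewrite cos_sqr_min /w cos_norm /ellipse_form /a /b /=.
have -> : ((s * (cos (alpha q) * cos (beta q))) ^+ 2 / (s * cos phi) ^+ 2 +
    (s * (sin (alpha q) * sin (beta q))) ^+ 2 / (s * sin phi) ^+ 2 - 1) *
    (cos phi ^+ 2 * sin phi ^+ 2) =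
   cos (alpha q) ^+ 2 * cos (beta q) ^+ 2 * sin phi ^+ 2 +
   sin (alpha q) ^+ 2 * sin (beta q) ^+ 2 * cos phi ^+ 2 -
   cos phi ^+ 2 * sin phi ^+ 2.
  by field; rewrite cphi sphi s0'.
by rewrite !sin2cos2; ring.
Qed.

(** This gives the sign of <d, d>, on which the reflection depends. By the factorization, cos^2 A or
    cos^2 B equals cos^2 phi on the boundary, and the identity is checked after either
    substitution. *)
Lemma tangent_inflate q : ellipse_form a b (inflate q) = 1 ->
  let d := ellipse_tangent a b (inflate q) in
  (d.1 ^+ 2 - d.2 ^+ 2) * (s * cos phi * sin phi) ^+ 2 =
  2 * cos phi ^+ 2 - cos (u q) ^+ 2 - cos (w q) ^+ 2.
Proof.
have cphi := lt0r_neq0 cos_phi_gt0; have sphi := lt0r_neq0 sin_phi_gt0.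
have s0' := lt0r_neq0 s0.
move=> f1 d; have := form_inflate q; rewrite f1 subrr mul0r => /esym/eqP h.
apply: (mulIf (x := cos phi ^+ 2 * sin phi ^+ 2)); first by rewrite mulf_neq0// expf_neq0.
have -> : (d.1 ^+ 2 - d.2 ^+ 2) * (s * cos phi * sin phi) ^+ 2 *
   (cos phi ^+ 2 * sin phi ^+ 2) =
   (sin (alpha q) ^+ 2 * sin (beta q) ^+ 2 * (cos phi ^+ 2) ^+ 2 -
   cos (alpha q) ^+ 2 * cos (beta q) ^+ 2 * (sin phi ^+ 2) ^+ 2).
  by rewrite /d /a /b /=; field; rewrite cphi sphi s0'.
move: h; rewrite cos_sqr_min /w cos_norm !sin2cos2 mulf_eq0 !subr_eq0.
by move=> /orP[] /eqP ->; ring.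
Qed.

(** Since w <= phi <= u, the two factors in [form_inflate] have opposite signs. *)
Lemma form_inflate_le1 q : in_rectangle q -> ellipse_form a b (inflate q) <= 1.
Proof.
move=> /fold_bounds[wI uI wphi uphi].
rewrite -subr_le0 -(pmulr_lle0 _ (_ : 0 < cos phi ^+ 2 * sin phi ^+ 2)).
  rewrite form_inflate mulr_le0_ge0// ?subr_le0 ?subr_ge0 ler_cos_sqr ?phi_bounds//.
by rewrite mulr_gt0// exprn_gt0// ?cos_phi_gt0 ?sin_phi_gt0.
Qed.

Lemma form_inflate_eq1 q : in_rectangle q ->
  ellipse_form a b (inflate q) = 1 <-> u q = phi \/ w q = phi.
Proof.
move=> /fold_bounds[wI uI wphi uphi].
have -> : ellipse_form a b (inflate q) = 1 <->
  (ellipse_form a b (inflate q) - 1) * (cos phi ^+ 2 * sin phi ^+ 2) == 0.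
  rewrite mulf_eq0 mulf_eq0 !expf_eq0/= (gt_eqF cos_phi_gt0) (gt_eqF sin_phi_gt0).
  by rewrite !orbF subr_eq0; split=> /eqP.
rewrite form_inflate mulf_eq0 !subr_eq0 !cos_sqr_inj// ?phi_bounds//.
by split=> [/orP[]/eqP|[->|->]]; rewrite ?eqxx ?orbT//; [left|right].
Qed.

(** On a side w = phi, [tangent_inflate] leaves cos^2 phi - cos^2 u, which is positive except at a
    corner; on a side u = phi it leaves cos^2 phi - cos^2 w, negative except at a corner. Corners
    thus match light-like tangents. *)
Lemma tangent_cmp q :
  let x := (ellipse_tangent a b (inflate q)).1 ^+ 2 in
  let z := (ellipse_tangent a b (inflate q)).2 ^+ 2 in
  in_rectangle q -> ellipse_form a b (inflate q) = 1 ->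
  [\/ [/\ w q = phi, u q = phi & x = z],
      [/\ w q = phi, u q <> phi & z < x] |
      [/\ w q <> phi, u q = phi & x < z]].
Proof.
move=> x z qr f1; have [wI uI wphi uphi] := fold_bounds qr.
have /= := tangent_inflate f1; rewrite -/x -/z.
have k0 : 0 < (s * cos phi * sin phi) ^+ 2.
  by rewrite exprn_gt0// !mulr_gt0// ?cos_phi_gt0 ?sin_phi_gt0.
move=> xz.
have [wE|wN] := pselect (w q = phi); have [uE|uN] := pselect (u q = phi).
- constructor 1; split=> //; apply/eqP; rewrite -subr_eq0.
  move: xz; rewrite wE uE => xz.
  have /eqP : (x - z) * (s * cos phi * sin phi) ^+ 2 = 0 by lra.
  by rewrite mulf_eq0 (gt_eqF k0) orbF.
- constructor 2; split=> //; rewrite -subr_gt0 -(pmulr_lgt0 _ k0) xz wE.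
  have : phi < u q by rewrite lt_neqAle uphi andbT; apply/eqP => /esym.
  by rewrite -ltr_cos_sqr ?phi_bounds//; lra.
- constructor 3; split=> //; rewrite -subr_lt0 -(pmulr_llt0 _ k0) xz uE.
  have : w q < phi by rewrite lt_neqAle wphi andbT; apply/eqP.
  by rewrite -ltr_cos_sqr ?phi_bounds//; lra.
- by case/(form_inflate_eq1 qr): f1.
Qed.

Lemma diagonal_exchange v : diagonal_direction v -> diagonal_direction (exchange v).
Proof. by move=> [h1 h2]; split; rewrite /exchange/= sqrrN. Qed.

Lemma exchangeK v : exchange (exchange v) = v.
Proof. by apply: pairE; rewrite /= opprK. Qed.

(** The tangent vector does not vanish on the ellipse, so it is light-like as soon as its
    coordinates have equal squares; the other cases come from [minkowski_bounceE]. *)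
Lemma ellipse_bounceE p v v' : diagonal_direction v -> diagonal_direction v' ->
  let d := ellipse_tangent a b p in
  ellipse_bounce a b p v v' <->
  ellipse_form a b p = 1 /\
  [\/ d.1 ^+ 2 = d.2 ^+ 2 /\ v' = - v,
      d.1 ^+ 2 < d.2 ^+ 2 /\ v' = (- v.1, v.2) |
      d.2 ^+ 2 < d.1 ^+ 2 /\ v' = (v.1, - v.2)].
Proof.
move=> dv dv' d; rewrite /ellipse_bounce -/d.
have dN0 : ellipse_form a b p = 1 -> d <> 0.
  move=> f1 d0; have [d1 d2] : d.1 = 0 /\ d.2 = 0 by rewrite d0.
  move: f1; rewrite /ellipse_form.
  have -> : p.1 = d.2 * a by rewrite /d/= divfK// lt0r_neq0.
  have -> : p.2 = - d.1 * b by rewrite /d/= opprK divfK// lt0r_neq0.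
  by rewrite d1 d2 oppr0 !mul0r expr0n/= !mul0r addr0 => /eqP; rewrite eq_sym oner_eq0.
split=> [[f1 hl hn]|[f1 h]].
  split=> //; have [dd|dd] := eqVneq (d.1 ^+ 2) (d.2 ^+ 2).
    by constructor 1; split=> //; apply: hl; apply/lightlikeE; split=> //; exact: dN0.
  have : ~ lightlike d by move=> /lightlikeE[/eqP]; rewrite (negbTE dd).
  by move=> /hn /(minkowski_bounceE dv dv' dd)[h|h]; [constructor 2|constructor 3].
split=> // [/lightlikeE[dd _]|hd].
  by case: h => -[] //; rewrite dd ltxx.
have dd : d.1 ^+ 2 != d.2 ^+ 2.
  by apply/eqP => dd; apply: hd; apply/lightlikeE; split=> //; exact: dN0.
apply/(minkowski_bounceE dv dv' dd).
by case: h => -[h e]; [move: dd; rewrite h eqxx|left|right].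
Qed.

Lemma rectangle_bounceE q v v' :
  rectangle_bounce l1 l2 q v v' <->
  [\/ [/\ w q = phi, u q = phi & v' = - v],
      [/\ w q = phi, u q <> phi & v' = (- v.1, v.2)] |
      [/\ w q <> phi, u q = phi & v' = (v.1, - v.2)]].
Proof.
rewrite /rectangle_bounce.
have vE := on_verticalE q; have hE := on_horizontalE q.
have rv := vertical_reflectionE v v'; have rh := horizontal_reflectionE v v'.
by split=> -[] [h1 h2 h3]; [constructor 1|constructor 2|constructor 3|
  constructor 1|constructor 2|constructor 3]; split; tauto.
Qed.

(** [exchange] turns a sign change of one coordinate into a sign change of the other, and commutes
    with v |-> - v; [tangent_cmp] matches the three cases of the two laws. *)
Lemma bounce_inflate q v v' : in_rectangle q -> diagonal_direction v -> diagonal_direction v' ->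
  rectangle_bounce l1 l2 q v v' <->
  ellipse_bounce a b (inflate q) (exchange v) (exchange v').
Proof.
move=> qr dv dv'.
have eN : exchange (- v) = - exchange v by [].
have e1 : exchange (v.1, - v.2) = (- (exchange v).1, (exchange v).2).
  by apply: pairE.
have e2 : exchange (- v.1, v.2) = ((exchange v).1, - (exchange v).2).
  by apply: pairE.
have eI z : exchange v' = exchange z -> v' = z.
  by move=> /(congr1 exchange); rewrite !exchangeK.
have rE := rectangle_bounceE q v v'.
have eE := ellipse_bounceE (inflate q) (diagonal_exchange dv) (diagonal_exchange dv').
split.
  move=> /rE h; apply/eE.
  have f1 : ellipse_form a b (inflate q) = 1.
    by apply/(form_inflate_eq1 qr); case: h => -[]; [left|right|left].
  split=> //; case: (tangent_cmp qr f1) => -[t1 t2 t3]; case: h => -[h1 h2 ->] //.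
  - by constructor 1; rewrite eN.
  - by constructor 3; rewrite e2.
  - by constructor 2; rewrite e1.
move=> /eE[f1 h]; apply/rE; case: (tangent_cmp qr f1) => -[t1 t2 t3].
- constructor 1; split=> //; case: h => -[].
  + by move=> _ h; apply: eI; rewrite eN.
  + by rewrite t3 ltxx.
  + by rewrite t3 ltxx.
- constructor 2; split=> //; case: h => -[].
  + by move=> h; rewrite h ltxx in t3.
  + by move=> /(lt_trans t3); rewrite ltxx.
  + by move=> _ h; apply: eI; rewrite e2.
- constructor 3; split=> //; case: h => -[].
  + by move=> h; rewrite h ltxx in t3.
  + by move=> _ h; apply: eI; rewrite e1.
  + by move=> /(lt_trans t3); rewrite ltxx.
Qed.

Lemma inflate_sub q :
  (inflate q).1 - (inflate q).2 = s * cos (alpha q + beta q).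
Proof. by rewrite /= cosD; ring. Qed.

Lemma inflate_add q :
  (inflate q).1 + (inflate q).2 = s * cos (alpha q - beta q).
Proof. by rewrite /= cosB; ring. Qed.

Lemma angle_bounds q : in_rectangle q ->
  0 <= alpha q + beta q <= pi /\ 0 <= alpha q - beta q <= pi.
Proof.
move=> /in_rectangleE[]; rewrite /w /u ler_norml le_min => /andP[h1 h2] /andP[h3 h4].
by split; apply/andP; split; lra.
Qed.

Lemma inflateK q : in_rectangle q -> straighten (inflate q) = q.
Proof.
move=> /angle_bounds[hp hm].
rewrite /straighten /angle_minus /angle_plus inflate_sub inflate_add.
rewrite !(mulrC s) !mulfK ?lt0r_neq0// !cosK ?in_itv//.
by apply: pairE; rewrite /= ?[RHS]coord1E ?[RHS]coord2E; field.
Qed.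

(** Cauchy-Schwarz with a + b = s^2, the defect being written as an explicit square. The bound for x
    - y is the one for x + y applied to (x, - y). *)
Lemma angle_arguments p : ellipse_form a b p <= 1 ->
  -1 <= (p.1 - p.2) / s <= 1 /\ -1 <= (p.1 + p.2) / s <= 1.
Proof.
have cphi := lt0r_neq0 cos_phi_gt0; have sphi := lt0r_neq0 sin_phi_gt0.
have s0' := lt0r_neq0 s0.
move=> f1.
have sum_sqr (x y : R) : ((x + y) / s) ^+ 2 =
    x ^+ 2 / a + y ^+ 2 / b
    - ((x * sin phi / cos phi - y * cos phi / sin phi) / s) ^+ 2.
  (* Inserting cos^2 phi + sin^2 phi = 1 makes the identity purely rational in cos phi and sin
     phi. *)
  have -> : x ^+ 2 / a = x ^+ 2 * (cos phi ^+ 2 + sin phi ^+ 2) / a.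
    by rewrite cos2Dsin2 mulr1.
  have -> : y ^+ 2 / b = y ^+ 2 * (cos phi ^+ 2 + sin phi ^+ 2) / b.
    by rewrite cos2Dsin2 mulr1.
  by rewrite /a /b; field; rewrite cphi sphi s0'.
have sqr_le1 (x y : R) : x ^+ 2 / a + y ^+ 2 / b <= 1 -> -1 <= (x + y) / s <= 1.
  move=> h; rewrite -ler_norml -(@ler_sqr _ _ 1) ?nnegrE// expr1n real_normK ?num_real//.
  by rewrite sum_sqr (le_trans _ h)// gerBl sqr_ge0.
by split; apply: sqr_le1; rewrite ?sqrrN.
Qed.

Lemma alpha_straighten p : alpha (straighten p) = (angle_minus p + angle_plus p) / 2.
Proof. by rewrite /alpha /=; field; rewrite lt0r_neq0. Qed.

Lemma beta_straighten p : beta (straighten p) = (angle_minus p - angle_plus p) / 2.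
Proof. by rewrite /beta /=; field; rewrite lt0r_neq0. Qed.

Lemma straightenK p : ellipse_form a b p <= 1 -> inflate (straighten p) = p.
Proof.
move=> /angle_arguments[hm hp].
have := inflate_sub (straighten p); have := inflate_add (straighten p).
rewrite alpha_straighten beta_straighten.
have -> : (angle_minus p + angle_plus p) / 2 - (angle_minus p - angle_plus p) / 2
   = angle_plus p by field.
have -> : (angle_minus p + angle_plus p) / 2 + (angle_minus p - angle_plus p) / 2
   = angle_minus p by field.
rewrite !acosK ?in_itv// !(mulrC s) !divfK ?lt0r_neq0// => h1 h2.
by apply: pairE; lra.
Qed.

(** Inside the ellipse the product in [form_inflate] is at most 0, so phi lies between w and u in
    one order or the other; w <= u settles which. *)
Lemma straighten_in_rectangle p : ellipse_form a b p <= 1 -> in_rectangle (straighten p).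
Proof.
have [? ? ?] := bounds.
move=> f1; have [hm hp] := angle_arguments f1.
have := acos_ge0 hm; have := acos_ge0 hp; have := acos_lepi hm; have := acos_lepi hp.
rewrite -/(angle_minus p) -/(angle_plus p).
have := alpha_straighten p; have := beta_straighten p.
move: (angle_minus p) (angle_plus p) => x y bE aE yp xp y0 x0.
(* That X and Y lie in [0, pi] says precisely |B| <= min (A, pi - A). *)
have wu : w (straighten p) <= u (straighten p).
  by rewrite /w /u le_min !ler_norml; apply/andP; split; apply/andP; split; lra.
have w0 : 0 <= w (straighten p) by exact: normr_ge0.
have upi : u (straighten p) <= pi / 2.
  rewrite /u ge_min; apply/orP.
  by case: (lerP (alpha (straighten p)) (pi / 2)) => ?; [left|right; lra].
have wI : 0 <= w (straighten p) <= pi / 2 by rewrite w0 (le_trans wu).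
have uI : 0 <= u (straighten p) <= pi / 2 by rewrite upi (le_trans w0).
have prod_le0 : (cos (u (straighten p)) ^+ 2 - cos phi ^+ 2) *
    (cos (w (straighten p)) ^+ 2 - cos phi ^+ 2) <= 0.
  rewrite -form_inflate straightenK// mulr_le0_ge0 ?subr_le0//.
  by rewrite mulr_ge0 ?sqr_ge0.
(* If phi < w, the sign of the product forces u <= phi, hence u < w; if u < phi, it forces phi <= w,
   again u < w. *)
apply/in_rectangleE; split; rewrite leNgt; apply/negP => h.
- move: prod_le0; rewrite nmulr_lle0 ?subr_lt0 ?ltr_cos_sqr ?phi_bounds//.
  rewrite subr_ge0 ler_cos_sqr ?phi_bounds// => /le_lt_trans/(_ h).
  by rewrite ltNge wu.
- move: prod_le0; rewrite pmulr_rle0 ?subr_gt0 ?ltr_cos_sqr ?phi_bounds//.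
  rewrite subr_le0 ler_cos_sqr ?phi_bounds// => /(lt_le_trans h).
  by rewrite ltNge wu.
Qed.

(** A diagonal motion fixes one of the sum and the difference of the coordinates and moves the
    other. Sum and difference are affine in Y and X on the rectangle, and s cos Y and s cos X on the
    ellipse. The monotonicity of the cosine and the signs in [exchange] preserve orientation;
    elapsed times differ. *)
Lemma inflate_free q q' v : in_rectangle q -> in_rectangle q' ->
  diagonal_direction v ->
  (exists2 t, 0 <= t & q' = q + t *: v) <->
  (exists2 t, 0 <= t & inflate q' = inflate q + t *: exchange v).
Proof.
move=> qr q'r dv; have [v10 _] := diagonal_neq0 dv.
have [hp hm] := angle_bounds qr; have [hp' hm'] := angle_bounds q'r.
have sq0 : 0 < v.1 ^+ 2 by rewrite exprn_even_gt0.
have eqP2 (x y : R * R) (t : R) (z : R * R) : x = y + t *: z <->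
    x.1 - x.2 = y.1 - y.2 + t * (z.1 - z.2) /\
    x.1 + x.2 = y.1 + y.2 + t * (z.1 + z.2).
  split=> [->|[h1 h2]]; first by rewrite /= /GRing.scale/=; split; ring.
  by apply: pairE; rewrite /= /GRing.scale/=; lra.
have cosP (x y : R) : 0 <= x <= pi -> 0 <= y <= pi -> s * cos x = s * cos y -> x = y.
  by move=> xI yI /(mulfI (lt0r_neq0 s0)) /cos_inj; apply; rewrite in_itv.
have sum q1 : q1.1 + q1.2 = m * (alpha q1 - beta q1).
  by rewrite coord1E (coord2E q1); ring.
have dif q1 : q1.1 - q1.2 = m * (2 * phi - (alpha q1 + beta q1)).
  by rewrite coord1E (coord2E q1); ring.
have mN0 := lt0r_neq0 m0.
(* A displacement having the sign of the speed [c] takes a nonnegative time. The witness is k (x -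
   y) / c, expanded by [c] so that its sign is visible; [pos] below is the converse. *)
have time (k x y c : R) : c != 0 -> 0 < k -> 0 <= c * (x - y) ->
    exists2 t, 0 <= t & k * x = k * y + t * c.
  move=> c0 k0 h; exists (k * (c * (x - y)) / c ^+ 2).
    by rewrite divr_ge0 ?sqr_ge0// mulr_ge0// ltW.
  by field.
have pos (k x y c t : R) : 0 < k -> 0 <= t -> k * x = k * y + t * c -> 0 <= c * (x - y).
  move=> k0 t0 h; rewrite -(pmulr_rge0 _ k0).
  have -> : k * (c * (x - y)) = t * c ^+ 2 by rewrite mulrCA mulrBr h; ring.
  by rewrite mulr_ge0 ?sqr_ge0.
have v2N0 : 2 * v.1 != 0 by rewrite mulf_neq0.
(* Four cases: X constant and then Y constant, each with the two implications. *)
have [vE|vE] := diagonal_cases dv; split=> -[t t0 /eqP2].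
- rewrite (sum q) (sum q') (dif q) (dif q') vE => -[hd hs].
  have X : alpha q' + beta q' = alpha q + beta q.
    by apply: (mulfI mN0); lra.
  have Y : 0 <= - (2 * v.1) * (cos (alpha q' - beta q') - cos (alpha q - beta q)).
    rewrite cos_monotone//.
    have := @pos m (alpha q' - beta q') (alpha q - beta q) (2 * v.1) t m0 t0.
    by move=> /(_ ltac:(lra)); lra.
  have [|t' t'0 tE] := @time s _ _ _ _ s0 Y; first by rewrite oppr_eq0.
  exists t' => //; apply/eqP2; rewrite !inflate_sub !inflate_add /exchange/= vE X tE.
  by split; ring.
- rewrite !inflate_sub !inflate_add /exchange/= vE => -[hd hs].
  have X : alpha q' + beta q' = alpha q + beta q by apply: cosP => //; lra.
  have Y : 0 <= (2 * v.1) * ((alpha q' - beta q') - (alpha q - beta q)).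
    have := @pos s (cos (alpha q' - beta q')) (cos (alpha q - beta q)) (- (2 * v.1)) t s0 t0.
    by move=> /(_ ltac:(lra)); rewrite cos_monotone//; lra.
  have [t' t'0 tE] := @time m _ _ _ v2N0 m0 Y.
  by exists t' => //; apply/eqP2; rewrite (sum q) (sum q') (dif q) (dif q') vE X tE; split; ring.
- rewrite (sum q) (sum q') (dif q) (dif q') vE => -[hd hs].
  have Y : alpha q' - beta q' = alpha q - beta q.
    by apply: (mulfI mN0); lra.
  have X : 0 <= (2 * v.1) * (cos (alpha q' + beta q') - cos (alpha q + beta q)).
    rewrite cos_monotone//.
    have := @pos m (- (alpha q' + beta q')) (- (alpha q + beta q)) (2 * v.1) t m0 t0.
    by move=> /(_ ltac:(lra)); lra.
  have [t' t'0 tE] := @time s _ _ _ v2N0 s0 X.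
  exists t' => //; apply/eqP2; rewrite !inflate_sub !inflate_add /exchange/= vE Y tE.
  by split; ring.
- rewrite !inflate_sub !inflate_add /exchange/= vE => -[hd hs].
  have Y : alpha q' - beta q' = alpha q - beta q by apply: cosP => //; lra.
  have X : 0 <= (2 * v.1) * (- (alpha q' + beta q') - - (alpha q + beta q)).
    have := @pos s (cos (alpha q' + beta q')) (cos (alpha q + beta q)) (2 * v.1) t s0 t0.
    by move=> /(_ ltac:(lra)); rewrite cos_monotone//; lra.
  have [t' t'0 tE] := @time m _ _ _ v2N0 m0 X.
  by exists t' => //; apply/eqP2; rewrite (sum q) (sum q') (dif q) (dif q') vE Y; split; lra.
Qed.

(** Neither coordinate of [v] is 0, so both coordinates are strictly monotone along the segment and
    stay off the sides at intermediate times. *)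
Lemma rectangle_inside q v t r : diagonal_direction v -> in_rectangle q ->
  in_rectangle (q + t *: v) -> 0 < r < t ->
  0 < (q + r *: v).1 < l1 /\ 0 < (q + r *: v).2 < l2.
Proof.
move=> dv [/andP[a1 a2] /andP[a3 a4]] [/andP[]]; rewrite /= /GRing.scale/=.
move=> c1 c2 /andP[c3 c4] /andP[r0 rt].
have between (x y l : R) : y != 0 -> 0 <= x -> x <= l -> 0 <= x + t * y -> x + t * y <= l ->
    0 < x + r * y < l.
  move=> yN0 h1 h2 h3 h4; case: (ltrgtP y 0) => y0; last by rewrite y0 eqxx in yN0.
  - have h5 : t * y < r * y by rewrite ltr_nM2r.
    have h6 : r * y < 0 by rewrite nmulr_llt0.
    by apply/andP; split; lra.
  - have h5 : r * y < t * y by rewrite ltr_pM2r.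
    have h6 : 0 < r * y by rewrite mulr_gt0.
    by apply/andP; split; lra.
by have [v1 v2] := diagonal_neq0 dv; split; apply: between.
Qed.

(** Strict convexity of a positive definite quadratic form; [convex] gives the exact defect. *)
Lemma ellipse_inside p v t r : diagonal_direction v -> ellipse_form a b p <= 1 ->
  ellipse_form a b (p + t *: v) <= 1 -> 0 < r < t ->
  ellipse_form a b (p + r *: v) < 1.
Proof.
move=> dv f0 f1 /andP[r0 rt]; have t0 := lt_trans r0 rt.
have convex : t * ellipse_form a b (p + r *: v) =
   (t - r) * ellipse_form a b p + r * ellipse_form a b (p + t *: v)
   - r * (t - r) * t * ellipse_form a b v.
  rewrite /ellipse_form /= /GRing.scale/= ; field.
  by rewrite !lt0r_neq0.
have fv : 0 < ellipse_form a b v.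
  have [v1 v2] := diagonal_neq0 dv.
  by rewrite /ellipse_form addr_gt0// divr_gt0// exprn_even_gt0.
rewrite -(ltr_pM2l t0) mulr1 convex.
have h1 : (t - r) * ellipse_form a b p <= t - r by rewrite ger_pMr// subr_gt0.
have h2 : r * ellipse_form a b (p + t *: v) <= r by rewrite ger_pMr.
have h3 : 0 < r * (t - r) * t * ellipse_form a b v by rewrite !mulr_gt0// subr_gt0.
lra.
Qed.

End Coordinates.

(** * Restriction of maps to subsets viewed as types *)

Section SetMap.
Variables (X Y : Type) (A : set X) (B : set Y) (F : X -> Y).
Hypothesis FAB : forall x, A x -> B (F x).

Definition set_map (x : A) : B := exist _ (F (set_val x)) (mem_set (FAB (set_valP x))).

Lemma set_mapE x : set_val (set_map x) = F (set_val x).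
Proof. by rewrite !set_valE. Qed.

End SetMap.

(** * The isomorphism between the two spaces of states *)

Section Equivalence.
Variables (R : realType) (s phi m : R).
Hypotheses (s0 : 0 < s) (phi0 : 0 < phi) (phi_pi2 : phi < pi / 2) (m0 : 0 < m).
Implicit Types p q v : R * R.

Let a := (s * cos phi) ^+ 2.
Let b := (s * sin phi) ^+ 2.
Let l1 := m * (2 * phi).
Let l2 := m * (pi - 2 * phi).
Let E := lightlike_ellipse_billiard a b.
Let T := diagonal_rectangle_billiard l1 l2.
Local Notation inflate := (inflate s phi m).
Local Notation straighten := (straighten s phi m).

Lemma ellipse_statesE x : states E x <->
  ellipse_form a b x.1 <= 1 /\ diagonal_direction x.2.
Proof. by split=> -[h1 /lightlike_directionE h2]. Qed.

Lemma rectangle_statesE x : states T x <->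
  in_rectangle phi m x.1 /\ diagonal_direction x.2.
Proof. by split=> -[h1 /rectangle_directionE h2]. Qed.

Lemma straighten_states x : states E x -> states T (straighten x.1, exchange x.2).
Proof.
move=> /ellipse_statesE[x1 x2]; apply/rectangle_statesE; split.
  exact: straighten_in_rectangle.
exact: diagonal_exchange.
Qed.

Lemma inflate_states x : states T x -> states E (inflate x.1, exchange x.2).
Proof.
move=> /rectangle_statesE[x1 x2]; apply/ellipse_statesE; split.
  exact: form_inflate_le1.
exact: diagonal_exchange.
Qed.

Definition state_straighten : states E -> states T := set_map straighten_states.
Definition state_inflate : states T -> states E := set_map inflate_states.

Lemma state_inflateK : cancel state_inflate state_straighten.
Proof.
move=> x; apply: val_inj; rewrite -!set_valE !set_mapE /= exchangeK inflateK//.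
  by rewrite -surjective_pairing.
by have /rectangle_statesE[] := set_valP x.
Qed.

Lemma state_straightenK : cancel state_straighten state_inflate.
Proof.
move=> x; apply: val_inj; rewrite -!set_valE !set_mapE /= exchangeK straightenK//.
  by rewrite -surjective_pairing.
by have /ellipse_statesE[] := set_valP x.
Qed.

Lemma pos_inflate x : pos (state_inflate x) = inflate (pos x).
Proof. by rewrite /pos set_mapE. Qed.

Lemma dir_inflate x : dir (state_inflate x) = exchange (dir x).
Proof. by rewrite /dir set_mapE. Qed.

Lemma bounces_inflate x y :
  bounces x y <-> bounces (state_inflate x) (state_inflate y).
Proof.
have /rectangle_statesE[x1 x2] := set_valP x.
have /rectangle_statesE[y1 y2] := set_valP y.
rewrite /bounces !pos_inflate !dir_inflate; split=> -[xy bxy].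
  split; first by rewrite xy.
  exact/(bounce_inflate s0 phi0 phi_pi2 m0 x1 x2 y2).
split; first by rewrite -[LHS](inflateK s0 phi0 phi_pi2 m0 x1) xy inflateK.
exact/(bounce_inflate s0 phi0 phi_pi2 m0 x1 x2 y2).
Qed.

(** The condition of [flow_free] on the open segment holds because both end points are in the
    table. *)
Lemma flow_rectangle (x y : states T) t :
  0 <= t -> dir y = dir x -> pos y = pos x + t *: dir x -> flow x t y.
Proof.
have /rectangle_statesE[x1 x2] := set_valP x.
have /rectangle_statesE[y1 y2] := set_valP y.
move=> t0 dE pE; apply: flow_free => // r rt.
by apply: (rectangle_inside x2 x1 _ rt); rewrite -pE.
Qed.

Lemma flow_ellipse (x y : states E) t :
  0 <= t -> dir y = dir x -> pos y = pos x + t *: dir x -> flow x t y.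
Proof.
have /ellipse_statesE[x1 x2] := set_valP x.
have /ellipse_statesE[y1 y2] := set_valP y.
move=> t0 dE pE; apply: flow_free => // r rt.
by apply: (ellipse_inside s0 phi0 phi_pi2 x2 x1 _ rt); rewrite -pE.
Qed.

Lemma flow_inflate x t y : flow x t y ->
  exists t', flow (state_inflate x) t' (state_inflate y).
Proof.
apply: flow_morphism => {x t y} [x y /bounces_inflate//|x t y t0 dE pE].
have /rectangle_statesE[x1 x2] := set_valP x.
have /rectangle_statesE[y1 y2] := set_valP y.
have [|t' t'0 h] := (inflate_free s0 phi0 phi_pi2 m0 x1 y1 x2).1; first by exists t.
by exists t'; apply: flow_ellipse => //; rewrite ?pos_inflate ?dir_inflate// dE.
Qed.

Lemma flow_straighten x t y : flow x t y ->
  exists t', flow (state_straighten x) t' (state_straighten y).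
Proof.
apply: flow_morphism => {x t y} [x y h|x t y t0 dE pE].
  by apply/bounces_inflate; rewrite !state_straightenK.
(* Both states are written as images under [state_inflate], so that the converse half of
   [inflate_free] applies. *)
move: dE pE; have xK := state_straightenK x; have yK := state_straightenK y.
move: (state_straighten x) (state_straighten y) xK yK => x' y' <- <- {x y}.
rewrite !pos_inflate !dir_inflate => /(congr1 (@exchange R)); rewrite !exchangeK => dE pE.
have /rectangle_statesE[x1 x2] := set_valP x'.
have /rectangle_statesE[y1 y2] := set_valP y'.
have [|t' t'0 h] := (inflate_free s0 phi0 phi_pi2 m0 x1 y1 x2).2; first by exists t.
by exists t'; apply: flow_rectangle.
Qed.

Lemma exchange_continuous : continuous (@exchange R).
Proof.
apply: continuous_pair => x; apply: cvgN; [exact: cvg_snd|exact: cvg_fst].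
Qed.

Lemma inflate_continuous : continuous inflate.
Proof.
have ca : continuous (alpha phi m).
  move=> x; apply: cvgD; first exact: cvg_cst.
  by apply: cvgM; [exact: cvg_snd|exact: cvg_cst].
have cb : continuous (beta phi m).
  move=> x; apply: cvgB; first exact: cvg_cst.
  by apply: cvgM; [exact: cvg_fst|exact: cvg_cst].
have cc (f g : R * R -> R) : continuous f -> continuous g ->
    continuous (fun q => s * (f q * g q)).
  by move=> cf cg x; apply: cvgM; [exact: cvg_cst|apply: cvgM; [exact: cf|exact: cg]].
have comp (f : R -> R) (g : R * R -> R) : continuous f -> continuous g ->
    continuous (fun q => f (g q)).
  by move=> cf cg x; apply: (@continuous_comp _ _ _ g f); [exact: cg|exact: cf].
have cosc := @continuous_cos R; have sinc := @continuous_sin R.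
by apply: continuous_pair; apply: cc; apply: comp.
Qed.

Lemma state_inflate_continuous : continuous state_inflate.
Proof.
apply: continuous_set_type.
have -> : set_val \o state_inflate =
    (fun x => (inflate x.1, exchange x.2)) \o (set_val : states T -> _).
  by apply/funext => x; exact: set_mapE.
move=> x; apply: continuous_comp; first exact: set_val_continuous.
apply: continuous_pair => {}x; apply: continuous_comp.
- exact: cvg_fst.
- exact: inflate_continuous.
- exact: cvg_snd.
- exact: exchange_continuous.
Qed.

Lemma pos_continuous : continuous (@pos R E).
Proof.
move=> x; apply: (@continuous_comp _ _ _ (set_val : states E -> _) fst).
  exact: set_val_continuous.
exact: cvg_fst.
Qed.

(** Stated on states and not on the plane: the arguments of [acos] are known to lie in [-1, 1] only
    over the table. *)
Lemma angles_continuous :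
  continuous (fun x : states E => angle_minus s (pos x)) /\
  continuous (fun x : states E => angle_plus s (pos x)).
Proof.
split.
- apply: (@continuous_acos_comp _ _ (fun x : states E => ((pos x).1 - (pos x).2) / s)).
    move=> x; have /ellipse_statesE[x1 _] := set_valP x.
    by have [] := angle_arguments s0 phi0 phi_pi2 x1.
  have lin : continuous (fun p : R * R => (p.1 - p.2) / s).
    move=> p; apply: cvgM; last exact: cvg_cst.
    by apply: cvgB; [exact: cvg_fst|exact: cvg_snd].
  move=> x; apply: (@continuous_comp _ _ _ (@pos R E) (fun p => (p.1 - p.2) / s)).
    exact: pos_continuous.
  exact: lin.
- apply: (@continuous_acos_comp _ _ (fun x : states E => ((pos x).1 + (pos x).2) / s)).
    move=> x; have /ellipse_statesE[x1 _] := set_valP x.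
    by have [] := angle_arguments s0 phi0 phi_pi2 x1.
  have lin : continuous (fun p : R * R => (p.1 + p.2) / s).
    move=> p; apply: cvgM; last exact: cvg_cst.
    by apply: cvgD; [exact: cvg_fst|exact: cvg_snd].
  move=> x; apply: (@continuous_comp _ _ _ (@pos R E) (fun p => (p.1 + p.2) / s)).
    exact: pos_continuous.
  exact: lin.
Qed.

Lemma state_straighten_continuous : continuous state_straighten.
Proof.
have [cm cp] := angles_continuous.
apply: continuous_set_type.
have -> : set_val \o state_straighten =
    (fun x : states E => (straighten (pos x), exchange (dir x))).
  by apply/funext => x; exact: set_mapE.
apply: continuous_pair; last first.
  move=> x; apply: (@continuous_comp _ _ _ (@dir R E) (@exchange R)).
    apply: (@continuous_comp _ _ _ (set_val : states E -> _) snd).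
      exact: set_val_continuous.
    exact: cvg_snd.
  exact: exchange_continuous.
have pair (X : topologicalType) (f g : X -> R) : continuous f -> continuous g ->
    continuous (fun x => (m * (phi - (f x - g x) / 2), m * ((f x + g x) / 2 - phi))).
  move=> cf cg; apply: continuous_pair => x; (apply: cvgM; first exact: cvg_cst);
    apply: cvgB; try exact: cvg_cst; (apply: cvgM; last exact: cvg_cst).
    by apply: cvgB; [exact: cf|exact: cg].
  by apply: cvgD; [exact: cf|exact: cg].
exact: pair cm cp.
Qed.

Lemma ellipse_rectangle_equivalent : trajectorially_equivalent E T.
Proof.
apply: (@isomorphic_equivalent _ _ _ state_straighten state_inflate).
- split; first exact: state_straighten_continuous.
    by move=> x y h; apply/bounces_inflate; rewrite !state_straightenK.
  exact: flow_straighten.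
- split; first exact: state_inflate_continuous.
    by move=> x y /bounces_inflate.
  exact: flow_inflate.
- exact: state_straightenK.
- exact: state_inflateK.
Qed.

End Equivalence.

(** * Choice of the parameters for a given ellipse and rectangle *)

Theorem proposition3p6 (R : realType) (a b l1 l2 : R)
    (ha : 0 < a) (hb : 0 < b) (hl1 : 0 < l1) (hl2 : 0 < l2)
    (hratio : l1 / l2 = pi / (2 * atan (Num.sqrt (a / b))) - 1) :
  trajectorially_equivalent
    (lightlike_ellipse_billiard a b) (diagonal_rectangle_billiard l1 l2).
Proof.
have pi0 := pi_gt0 R.
set theta := atan _ in hratio.
have theta0 : 0 < theta.
  by rewrite -(atan0 R); apply: lt_atan; rewrite sqrtr_gt0 divr_gt0.
have theta_pi2 : theta < pi / 2 by exact: atan_ltpi2.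
(* The parametrization requires tan phi = sqrt (b / a), whereas tan theta = sqrt (a / b); hence the
   complementary angle. The scale [m] is fixed by the first side. *)
pose phi : R := pi / 2 - theta; pose s : R := Num.sqrt (a + b).
pose m : R := l1 / (2 * phi).
have phi0 : 0 < phi by rewrite /phi; lra.
have s0 : 0 < s by rewrite sqrtr_gt0 addr_gt0.
have m0 : 0 < m by rewrite divr_gt0// mulr_gt0.
have s2 : s ^+ 2 = a + b by rewrite sqr_sqrtr// ltW// addr_gt0.
have ab0 : a + b != 0 by rewrite lt0r_neq0// addr_gt0.
have b0 := lt0r_neq0 hb.
have cos2_theta : cos theta ^+ 2 = b / (a + b).
  rewrite cos_atan exprVn sqr_sqrtr ?addr_ge0 ?sqr_ge0// sqr_sqrtr ?divr_ge0 ?ltW//.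
  have -> : 1 + a / b = (a + b) / b by field.
  by rewrite invf_div.
have cos_phi : cos phi = sin theta.
  by rewrite /phi addrC cosDpihalf sinN opprK.
have sin_phi : sin phi = cos theta.
  by rewrite /phi addrC sinDpihalf cosN.
have -> : a = (s * cos phi) ^+ 2.
  by rewrite exprMn cos_phi sin2cos2 cos2_theta s2; field.
have -> : b = (s * sin phi) ^+ 2.
  by rewrite exprMn sin_phi cos2_theta s2; field.
have l1E : l1 = m * (2 * phi) by rewrite divfK// mulf_neq0// lt0r_neq0.
have l2E : l2 = m * (pi - 2 * phi).
  have -> : pi - 2 * phi = 2 * theta by rewrite /phi; lra.
  (* The hypothesis on the ratio reads l1 / l2 = (pi / 2 - theta) / theta = phi / theta, so the
     second side also fits the scale [m]. *)
  have : l1 * theta = l2 * phi.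
    have -> : l1 = l2 * (l1 / l2) by rewrite mulrC divfK// lt0r_neq0.
    by rewrite hratio /phi; field; rewrite lt0r_neq0.
  move=> h; apply: (mulIf (lt0r_neq0 phi0)); rewrite -h /m; field.
  by rewrite lt0r_neq0.
rewrite {1}l1E l2E; apply: ellipse_rectangle_equivalent => //.
by rewrite /phi; lra.
Qed.
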